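(* Let $\mathcal{K} \subseteq \mathbb{R}^n$ be a pointed closed convex cone and let $x \in \mathcal{K}$. Let $\mathcal{F}(x,\mathcal{K})$ denote the minimal face of $\mathcal{K}$ containing $x$. Then $$\kappa(x) \leq \ell_{\mathcal{F}(x,\mathcal{K})} - 1 .$$ In particular, $\kappa(\mathcal{K}) \leq \ell_{\mathcal{K}} - 1$.
   Context: A closed convex cone $\mathcal{K}\subseteq\mathbb{R}^n$ is pointed if $\mathcal{K}\cap -\mathcal{K}=\{0\}$. A convex subset $\mathcal{F}$ of a closed convex set $C$ is a face of $C$ if, whenever $x,y\in C$ and $\alpha x+(1-\alpha)y\in\mathcal{F}$ for some $0<\alpha<1$, then $x,y\in\mathcal{F}$. An extreme ray of a pointed closed convex cone is a one-dimensional face of it. For $x\in\mathcal{K}$, the Carathéodory number $\kappa(x)$ is the smallest nonnegative integer $k$ such that $x=d_1+\cdots+d_k$ with each $d_i$ belonging to an extreme ray of $\mathcal{K}$ (the empty sum is $0$, so $\kappa(0)=0$). The Carathéodory number of $\mathcal{K}$ is $\kappa(\mathcal{K})=\max\{\kappa(x)\mid x\in\mathcal{K}\}$. A chain of faces of a closed convex cone is a finite sequence $\mathcal{F}_1\supsetneq\cdots\supsetneq\mathcal{F}_\ell$ of nonempty faces, each properly containing the next; its length is the number $\ell$ of faces. For a closed convex cone $\mathcal{K}$ (in particular for the face $\mathcal{F}(x,\mathcal{K})$, itself a closed convex cone), $\ell_{\mathcal{K}}$ denotes the length of the longest chain of faces of $\mathcal{K}$. *)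

(* Defs.v *)
From HB Require Import structures.
From mathcomp Require Import all_boot all_order all_algebra.
From mathcomp Require Import all_classical all_reals all_analysis.

Set Implicit Arguments.
Unset Strict Implicit.
Unset Printing Implicit Defensive.

Import Order.TTheory GRing.Theory Num.Theory.
Import numFieldNormedType.Exports.

Local Open Scope classical_set_scope.
Local Open Scope ring_scope.

Definition is_cone (R : realType) (n : nat) (K : set 'rV[R]_n) : Prop :=
  forall (a : R) (x : 'rV[R]_n), 0 <= a -> K x -> K (a *: x).

Definition closed_convex_cone (R : realType) (n : nat) (K : set 'rV[R]_n) : Prop :=
  [/\ K !=set0, closed K, convex_set K & is_cone K].

Definition pointed (R : realType) (n : nat) (K : set 'rV[R]_n) : Prop :=
  K `&` [set - x | x in K] = [set 0].

(* The empty set qualifies as a face; nonemptiness is required separately where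
   it matters. *)
Definition face (R : realType) (n : nat) (C F : set 'rV[R]_n) : Prop :=
  [/\ F `<=` C, convex_set F &
      forall (x y : 'rV[R]_n) (a : R), C x -> C y -> 0 < a < 1 ->
        F (a *: x + (1 - a) *: y) -> F x /\ F y].

(* The dimension of the affine hull: U is the linear space parallel to the
   affine hull of A, i.e. the span of the differences of points of A. *)
Definition has_dimension (R : realType) (n : nat) (A : set 'rV[R]_n) (d : nat) :
    Prop :=
  A !=set0 /\ exists U : {vspace 'rV[R]_n},
    [/\ \dim U = d,
        (forall x y : 'rV[R]_n, A x -> A y -> x - y \in U) &
        forall W : {vspace 'rV[R]_n},
          (forall x y : 'rV[R]_n, A x -> A y -> x - y \in W) -> (U <= W)%VS].

Definition extreme_ray (R : realType) (n : nat) (K F : set 'rV[R]_n) : Prop :=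
  face K F /\ has_dimension F 1.

Definition sum_of_extreme (R : realType) (n : nat) (K : set 'rV[R]_n)
    (x : 'rV[R]_n) (k : nat) : Prop :=
  exists d : 'I_k -> 'rV[R]_n,
    (forall i, exists2 F : set 'rV[R]_n, extreme_ray K F & F (d i)) /\
    x = \sum_(i < k) d i.

(* kappa(x), kappa(K) and ell_K are encoded as relations with their value k or l,
   so that asserting them includes existence of the minimum or maximum. *)
Definition caratheodory_number_at (R : realType) (n : nat) (K : set 'rV[R]_n)
    (x : 'rV[R]_n) (k : nat) : Prop :=
  sum_of_extreme K x k /\ forall j : nat, sum_of_extreme K x j -> (k <= j)%N.

Definition caratheodory_number (R : realType) (n : nat) (K : set 'rV[R]_n)
    (k : nat) : Prop :=
  (exists2 x, K x & caratheodory_number_at K x k) /\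
  (forall x, K x -> exists2 j : nat, caratheodory_number_at K x j & (j <= k)%N).

Definition face_chain (R : realType) (n : nat) (K : set 'rV[R]_n) (l : nat)
    (F : 'I_l -> set 'rV[R]_n) : Prop :=
  (forall i, face K (F i) /\ F i !=set0) /\
  (forall i j : 'I_l, j = i.+1 :> nat -> F j `<` F i).

Definition longest_chain_length (R : realType) (n : nat) (K : set 'rV[R]_n)
    (l : nat) : Prop :=
  (exists F : 'I_l -> set 'rV[R]_n, face_chain K F) /\
  (forall (m : nat) (F : 'I_m -> set 'rV[R]_n), face_chain K F -> (m <= l)%N).

Definition minimal_face (R : realType) (n : nat) (K : set 'rV[R]_n)
    (x : 'rV[R]_n) : set 'rV[R]_n :=
  \bigcap_(F in [set F | face K F /\ F x]) F.

Lemma minimal_faceP (R : realType) (n : nat) (K : set 'rV[R]_n) (x : 'rV[R]_n) :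
  convex_set K -> K x ->
  [/\ face K (minimal_face K x), minimal_face K x x &
      forall F, face K F -> F x -> minimal_face K x `<=` F].
Proof.
move=> cK Kx; have faceK : face K K by split.
split; last by move=> F fF Fx y; apply.
- split.
  + by move=> y; apply.
  + move=> y z t /[!inE] My Mz F FF; have [[_ cF _] _] := FF.
    by have := cF y z t; rewrite !inE; apply; [exact: My|exact: Mz].
  + move=> y z a Ky Kz a01 M; split=> F FF; have [[_ _ hF] _] := FF;
    by have [] := hF y z a Ky Kz a01 (M F FF).
- by move=> F [].
Qed.

(* Main.v *)
Require Import Defs.
From HB Require Import structures.
From mathcomp Require Import all_boot all_order all_algebra.
From mathcomp Require Import all_classical all_reals all_analysis.
From mathcomp Require Import zify lra.

Set Implicit Arguments.
Unset Strict Implicit.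
Unset Printing Implicit Defensive.

Import Order.TTheory GRing.Theory Num.Theory.
Import numFieldNormedType.Exports.
Local Open Scope classical_set_scope.
Local Open Scope ring_scope.

(** Why the theorem holds.  Let [x] be a nonzero point of the pointed closed
    convex cone [K], and let [d] be a nonzero point of an extreme ray inside the
    minimal face [F(x)] of [x].  Since [K] is closed and pointed, the half-line
    [x - t d] leaves [K] at some last parameter [t] ([exit_time]).  At the exit
    point [y = x - t d] no positive multiple of [d] can be subtracted any more,
    whereas every point [z] of [F(y)] satisfies [y - e z \in K] for a small
    [e > 0] ([minimal_face_absorb]).  So [d] is in [F(x)] but not in [F(y)], and
    [F(y)] is a strictly smaller face ([minimal_face_exit]).  Splitting off the
    single extreme summand [t d] thus shortens the longest chain of faces by at
    least one; repeating this until [0] is reached, where one face [{0}] is left,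
    writes [x] with at most [l - 1] summands ([sum_of_extreme_bound]).

    The same exit argument, with an arbitrary [w \in F(x)] off the line of [x] in
    place of [d], replaces [x] by a nonzero point with a smaller minimal face.  If
    there is no such [w] then [F(x)] is itself a ray.  Hence extreme rays exist
    ([extreme_ray_ex]).

    Both descents, and the very existence of longest chains, need chains of faces
    to have bounded length.  A face contains every point of [K] in its linear span
    ([face_span]), so picking a point in each face of a chain outside of the next
    one gives a linearly independent family ([chain_free]), and a chain has at
    most [n + 1] members. *)

(** * Convex cones and their faces *)

Lemma convex_setP (R : realType) (n : nat) (A : set 'rV[R]_n) :
  convex_set A <->
  forall (x y : 'rV[R]_n) (a : R), A x -> A y -> 0 <= a <= 1 ->
    A (a *: x + (1 - a) *: y).
Proof.
split=> [cA x y a Ax Ay a01|cA x y a].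
  by have := cA x y (Itv01 (andP a01).1 (andP a01).2); rewrite !inE; apply.
rewrite !inE => Ax Ay; apply: (cA x y a%:num) => //.
by rewrite ge0 le1.
Qed.

Definition convex_cone (R : realType) (n : nat) (A : set 'rV[R]_n) : Prop :=
  [/\ A 0, forall x y, A x -> A y -> A (x + y) & is_cone A].

Lemma convex_coneP (R : realType) (n : nat) (A : set 'rV[R]_n) :
  convex_cone A <-> [/\ A !=set0, convex_set A & is_cone A].
Proof.
split=> [[A0 AD AZ]|[[x Ax] /convex_setP cA AZ]].
  split=> //; first by exists 0.
  apply/convex_setP => x y a Ax Ay /andP[a0 a1].
  by apply: AD; apply: AZ => //; rewrite subr_ge0.
split=> //; first by rewrite -(scale0r x); exact: AZ.
move=> y z Ay Az.
have -> : y + z = 2 *: (2^-1 *: y + (1 - 2^-1) *: z).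
  have -> : 1 - 2^-1 = 2^-1 :> R by lra.
  by rewrite -scalerDr scalerA divff ?scale1r.
by apply: AZ => //; apply: cA => //; lra.
Qed.

(** For cones the segment condition in the definition of a face amounts to an
    algebraic one, with scalars rescaled away: a nonempty face is a subcone
    containing the summands of each of its points.  A nonempty face contains [0]
    because any point [x] of it is the midpoint of [0] and [2 x]. *)
Lemma faceP (R : realType) (n : nat) (K F : set 'rV[R]_n) :
  convex_cone K ->
  (face K F /\ F !=set0) <->
  [/\ F `<=` K, convex_cone F &
      forall u v, K u -> K v -> F (u + v) -> F u].
Proof.
move=> [K0 KD KZ]; split=> [[[FK cF hF] [x Fx]]|[FK cF hF]].
  have F0 : F 0.
    have := hF 0 (2 *: x) 2^-1 K0; case=> //; first by apply: KZ => //; exact: FK.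
    - lra.
    - rewrite scaler0 add0r scalerA (_ : _ * _ = 1) ?scale1r //; lra.
  have FZ : is_cone F.
    move=> a y a0 Fy; have [a1|a1] := leP a 1.
      rewrite -[_ *: _]addr0 -(scaler0 _ (1 - a)).
      by move/convex_setP : cF; apply => //; rewrite a0.
    have an0 : 0 < a by lra.
    case: (hF (a *: y) 0 a^-1) => //; first by apply: KZ => //; exact: FK.
      by rewrite invr_gt0 an0 invf_lt1.
    by rewrite scaler0 addr0 scalerA mulVf ?gt_eqF // scale1r.
  have cnF : convex_cone F by apply/convex_coneP; split => //; exists x.
  split=> // u v Ku Kv Fuv.
  case: (hF u v 2^-1) => //; first lra.
  have -> : 1 - 2^-1 = 2^-1 :> R by lra.
  by rewrite -scalerDr; apply: FZ.
have [F0 FD FZ] := cF; have /convex_coneP[_ convF _] := cF.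
split; last by exists 0.
have sc (y : 'rV[R]_n) (b : R) : 0 < b -> F (b *: y) -> F y.
  move=> b0 /(FZ b^-1); rewrite invr_ge0 ltW // scalerA mulVf ?gt_eqF //.
  by rewrite scale1r; apply.
split=> // x y a Kx Ky /andP[a0 a1] Fxy.
have Kax : K (a *: x) by apply: KZ => //; exact: ltW.
have Kay : K ((1 - a) *: y) by apply: KZ => //; rewrite subr_ge0 ltW.
split; first by apply: (sc _ a) => //; apply: hF Fxy.
by apply: (sc _ (1 - a)); rewrite ?subr_gt0 //; apply: hF Kax _; rewrite // addrC.
Qed.

Lemma face_trans (R : realType) (n : nat) (K F G : set 'rV[R]_n) :
  face K F -> face F G -> face K G.
Proof.
move=> [FK cF hF] [GF cG hG]; split=> //; first exact: subset_trans FK.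
move=> x y a Kx Ky a01 Gxy; have [Fx Fy] := hF x y a Kx Ky a01 (GF _ Gxy).
exact: hG Gxy.
Qed.

Lemma face_subset (R : realType) (n : nat) (K F G : set 'rV[R]_n) :
  F `<=` K -> G `<=` F -> face K G -> face F G.
Proof.
move=> FK GF [_ cG hG]; split=> // x y a Fx Fy.
by apply: hG; exact: FK.
Qed.

(** * Lengths of chains of faces *)

(** Sorting the coefficients of a linear combination by sign writes it as a
    difference of two conic combinations. *)
Lemma span_convex_cone (R : realType) (n : nat) (F : set 'rV[R]_n)
    (s : seq 'rV[R]_n) (x : 'rV[R]_n) :
  convex_cone F -> {in s, forall y, F y} -> x \in span s ->
  exists u v, [/\ F u, F v & x = u - v].
Proof.
move=> [F0 FD FZ]; elim: s x => [|z s IHs] x Fs.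
  by rewrite span_nil memv0 => /eqP ->; exists 0, 0; rewrite subr0.
rewrite span_cons => /memv_addP[_ /vlineP[c ->] [y ys ->]].
have [|u [v [Fu Fv ->]]] := IHs y _ ys.
  by move=> w ws; apply: Fs; rewrite inE ws orbT.
have Fz : F z by apply: Fs; rewrite mem_head.
have [c0|c0] := leP 0 c.
  by exists (c *: z + u), v; rewrite addrA; split => //; apply: FD => //; exact: FZ.
exists u, (- c *: z + v); split => //; first by apply: FD => //; apply: FZ => //; lra.
by rewrite scaleNr opprD opprK addrCA.
Qed.

(** If [x = u - v] with [u] and [v] in the face, then [x] is a summand of
    [u = x + v].  Hence a face is determined by its span. *)
Lemma face_span (R : realType) (n : nat) (K F : set 'rV[R]_n)
    (s : seq 'rV[R]_n) (x : 'rV[R]_n) :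
  convex_cone K -> face K F -> F !=set0 -> {in s, forall y, F y} ->
  K x -> x \in span s -> F x.
Proof.
move=> cK fF F0 Fs Kx xs; have [FK cF hF] := (faceP _ cK).1 (conj fF F0).
have [u [v [Fu Fv xuv]]] := span_convex_cone cF Fs xs.
apply: (hF x v) => //; first exact: FK.
by rewrite xuv subrK.
Qed.

(** The family has one point of each face outside of the next one; by
    [face_span] that point is not spanned by those chosen further down. *)
Lemma chain_free (R : realType) (n m : nat) (K : set 'rV[R]_n)
    (F : 'I_m.+1 -> set 'rV[R]_n) :
  convex_cone K -> face_chain K F ->
  exists s : seq 'rV[R]_n,
    [/\ free s, size s = m & {in s, forall y, F ord0 y}].
Proof.
move=> cK; elim: m F => [|m IHm] F [faF ltF].
  by exists [::]; split => //; rewrite nil_free.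
pose G (i : 'I_m.+1) := F (lift ord0 i).
have chG : face_chain K G.
  split=> [i|i j ij]; first exact: faF.
  by apply: ltF; rewrite /= /bump /= ij.
have [s [frs szs Gs]] := IHm G chG.
have GF : G ord0 `<` F ord0 by exact: ltF.
have [GF' /nonsubset[x [Fx nGx]]] := GF.
exists (x :: s); split; last 1 first.
- by move=> y /[!inE] /predU1P[->//|ys]; apply: GF'; exact: Gs.
- rewrite free_cons frs andbT; apply/negP => xs; apply: nGx.
  have [fG G0] := faF (lift ord0 ord0).
  have [[FK _ _] _] := faF ord0.
  exact: (face_span cK fG G0 Gs (FK _ Fx) xs).
- by rewrite /= szs.
Qed.

Lemma chain_bound (R : realType) (n m : nat) (K : set 'rV[R]_n)
    (F : 'I_m -> set 'rV[R]_n) :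
  convex_cone K -> face_chain K F -> (m <= n.+1)%N.
Proof.
case: m F => [//|m] F cK /(chain_free cK)[s [/eqP frs szs _]].
by rewrite ltnS -szs -frs (leq_trans (dimvS (subvf _))) // dimvf /dim /= mul1n.
Qed.

Lemma chain_singleton (R : realType) (n : nat) (K : set 'rV[R]_n) :
  convex_cone K -> face_chain K (fun _ : 'I_1 => K).
Proof.
move=> cK; split; last by move=> [[|[]]//] ? [[|[]]//].
by move=> _; apply/faceP => //; split.
Qed.

Lemma longest_chain_ex (R : realType) (n : nat) (K : set 'rV[R]_n) :
  convex_cone K -> exists l, longest_chain_length K l.
Proof.
move=> cK.
pose P l := `[< exists F : 'I_l -> set 'rV[R]_n, face_chain K F >].
have exP : exists l, P l.
  by exists 1%N; apply/asboolP; exists (fun=> K); exact: chain_singleton.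
have bP l : P l -> (l <= n.+1)%N.
  by move/asboolP => [F]; exact: chain_bound.
case: (ex_maxnP exP bP) => l /asboolP Pl lmax.
exists l; split=> // m F chF.
by apply: lmax; apply/asboolP; exists F.
Qed.

Lemma longest_chain_gt0 (R : realType) (n l : nat) (K : set 'rV[R]_n) :
  convex_cone K -> longest_chain_length K l -> (0 < l)%N.
Proof. by move=> cK [_]; apply; exact: chain_singleton. Qed.

Lemma chain_face (R : realType) (n m : nat) (K G : set 'rV[R]_n)
    (F : 'I_m -> set 'rV[R]_n) :
  face K G -> face_chain G F -> face_chain K F.
Proof.
move=> fG [fF ltF]; split=> // i; split; last exact: (fF i).2.
exact: face_trans fG (fF i).1.
Qed.

Lemma chain_cons (R : realType) (n m : nat) (K G : set 'rV[R]_n)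
    (F : 'I_m -> set 'rV[R]_n) :
  convex_cone K -> face K G -> G `<` K -> face_chain G F ->
  exists F' : 'I_m.+1 -> set 'rV[R]_n, face_chain K F'.
Proof.
move=> cK fG GK chF; have [fF ltF] := chain_face fG chF.
exists (fun i => if unlift ord0 i is Some j then F j else K).
split=> [i|i j].
  case: (unliftP ord0 i) => [j _|_]; first exact: fF.
  by apply/faceP => //; split.
case: (unliftP ord0 j) => [j' ->|->//]; rewrite lift0 => -[].
case: (unliftP ord0 i) => [i' ->|->] ij; first by apply: ltF; rewrite ij lift0.
have [[FG _ _] _] := chF.1 j'; have [GsK nKG] := GK.
by split; [exact: subset_trans GsK|move=> /subset_trans /(_ FG)].
Qed.

Lemma longest_chain_face (R : realType) (n l m : nat) (K G : set 'rV[R]_n) :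
  face K G -> longest_chain_length K l -> longest_chain_length G m ->
  (m <= l)%N.
Proof.
by move=> fG [_ hK] [[F chF] _]; apply: (hK m F); exact: chain_face fG chF.
Qed.

Lemma longest_chain_proper (R : realType) (n l m : nat) (K G : set 'rV[R]_n) :
  convex_cone K -> face K G -> G `<` K ->
  longest_chain_length K l -> longest_chain_length G m -> (m < l)%N.
Proof.
move=> cK fG GK [_ hK] [[F chF] _].
by have [F' /hK] := chain_cons cK fG GK chF.
Qed.

(** * Moving along a ray to the relative boundary *)

(** The one-dimensional limit behind both uses of closedness in [exit_time]: the
    supremum of the admissible parameters is attained, and a direction in which
    [K] is unbounded belongs to [K]. *)
Lemma closed_ray (R : realType) (n : nat) (K : set 'rV[R]_n) (a b : 'rV[R]_n) :
  closed K -> (forall s : R, 0 < s -> K (a + s *: b)) -> K a.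
Proof.
move=> cK Ks.
apply: (@closed_cvg _ _ (0 : R)^'+ _ (fun s : R => a + s *: b) K) => //.
  near=> s; apply: Ks; near: s; exact: nbhs_right_gt.
rewrite -[X in _ --> X]addr0 -(scale0r b); apply: cvg_at_right_filter.
by apply: cvgD; [exact: cvg_cst|apply: cvgZr_tmp; exact: cvg_id].
Unshelve. all: by end_near. Qed.

(** If [x - t d] stayed in [K] for arbitrarily large [t], then so would
    [s x - d] for small [s = 1/t], and in the limit [- d] would belong to [K],
    against pointedness. *)
Lemma exit_time (R : realType) (n : nat) (K : set 'rV[R]_n) (x d : 'rV[R]_n) :
  closed K -> convex_cone K -> pointed K -> K x -> K d -> d != 0 ->
  exists t : R, [/\ 0 <= t, K (x - t *: d) &
    forall e, 0 < e -> ~ K (x - t *: d - e *: d)].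
Proof.
move=> clK [K0 KD KZ] pK Kx Kd d0.
(* [S] is a down-set: lowering [t] adds a nonnegative multiple of [d]. *)
pose S : set R := [set t | K (x - t *: d)].
have Sdown t u : u <= t -> S t -> S u.
  move=> ut St; rewrite /S /= -(subrK t u) scalerDl opprD.
  rewrite -scaleNr opprB addrCA addrC.
  by apply: KD => //; apply: KZ => //; rewrite subr_ge0.
have S0 : S 0 by rewrite /S /= scale0r subr0.
have ubS : has_ubound S.
  apply: contrapT => nub; move/eqP: d0; apply.
  have : [set 0 : 'rV[R]_n] (- d).
    rewrite -pK; split; last by exists d.
    apply: (@closed_ray _ _ _ _ x) => // s s0.
    have Ssv : S s^-1.
      apply: contrapT => nS; apply: nub; exists s^-1 => t St.
      by rewrite leNgt; apply/negP => st; apply: nS; apply: Sdown St; exact: ltW.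
    have := KZ s _ (ltW s0) Ssv.
    by rewrite scalerBr scalerA divff ?gt_eqF // scale1r addrC.
  by move=> /= /eqP; rewrite oppr_eq0 => /eqP.
have supS : has_sup S by split => //; exists 0.
exists (sup S); split.
- exact: ub_le_sup.
- apply: (@closed_ray _ _ _ _ d) => // s s0.
  have [t St ts] := sup_adherent s0 supS.
  have := Sdown _ _ (ltW ts) St.
  by rewrite /S /= scalerBl opprB addrA addrAC.
- move=> e e0; rewrite -addrA -opprD -scalerDl => Se.
  have : sup S + e <= sup S by exact: ub_le_sup.
  by lra.
Qed.

(** * Minimal faces shrink at the exit point *)

Lemma minimal_face_cone (R : realType) (n : nat) (K : set 'rV[R]_n)
    (x : 'rV[R]_n) :
  convex_cone K -> K x -> face K (minimal_face K x) /\
    [/\ minimal_face K x x, minimal_face K x `<=` K &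
        convex_cone (minimal_face K x)].
Proof.
move=> cK Kx; have /convex_coneP[_ convK _] := cK.
have [fx xx _] := minimal_faceP convK Kx; split=> //.
have Fx0 : minimal_face K x !=set0 by exists x.
by have [] := (faceP _ cK).1 (conj fx Fx0).
Qed.

(** The points [z] of [K] with [x - e z \in K] for some [e > 0] form a face
    containing [x] (take [e = 1]), so they contain the minimal one. *)
Lemma minimal_face_absorb (R : realType) (n : nat) (K : set 'rV[R]_n)
    (x y : 'rV[R]_n) :
  convex_cone K -> K x -> minimal_face K x y ->
  exists2 e : R, 0 < e & K (x - e *: y).
Proof.
move=> cK Kx; pose D := [set z | K z /\ exists2 e : R, 0 < e & K (x - e *: z)].
have [K0 KD KZ] := cK.
suff fD : face K D.
  move=> /(_ D) []// ; split => //; split => //.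
  by exists 1 => //; rewrite scale1r subrr.
suff [] : face K D /\ D !=set0 by [].
apply/(faceP _ cK); split; first by move=> z [].
  split.
  - by split=> //; exists 1 => //; rewrite scaler0 subr0.
  - move=> u v [Ku [e e0 Ke]] [Kv [f f0 Kf]]; split; first exact: KD.
    (* The weight making e * f / (e + f) the common coefficient of u and v. *)
    exists (e * f / (e + f)); first by rewrite divr_gt0 ?mulr_gt0 ?addr_gt0.
    have ef : e + f != 0 by rewrite gt_eqF // addr_gt0.
    have -> : x - (e * f / (e + f)) *: (u + v) =
        (f / (e + f)) *: (x - e *: u) + (e / (e + f)) *: (x - f *: v).
      rewrite !scalerBr !scalerA addrACA -scalerDl -mulrDl (addrC f) divff //.
      rewrite scale1r -opprD scalerDr; congr (_ - (_ *: _ + _ *: _)).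
        by rewrite [RHS]mulrAC (mulrC f).
      by rewrite mulrAC.
    by apply: KD; apply: KZ => //; rewrite divr_ge0 ?addr_ge0 ?ltW.
  - move=> a z a0 [Kz [e e0 Ke]]; split; first exact: KZ.
    have [->|an0] := eqVneq a 0; first by exists 1 => //; rewrite scale0r scaler0 subr0.
    have {}a0 : 0 < a by rewrite lt_neqAle eq_sym an0.
    by exists (e / a); [rewrite divr_gt0|rewrite scalerA divfK].
move=> u v Ku Kv [_ [e e0 Ke]]; split=> //; exists e => //.
have -> : x - e *: u = x - e *: (u + v) + e *: v.
  by rewrite scalerDr opprD addrA subrK.
by apply: KD => //; apply: KZ => //; exact: ltW.
Qed.

(** The descent step: [x] is the sum of the exit point and [t d], so the exit point
    lies in the minimal face of [x]; but [d] does not lie in that of the exit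
    point, by maximality of [t]. *)
Lemma minimal_face_exit (R : realType) (n : nat) (K : set 'rV[R]_n)
    (x d : 'rV[R]_n) :
  closed K -> convex_cone K -> pointed K -> K x -> minimal_face K x d -> d != 0 ->
  exists t : R, [/\ 0 <= t, K (x - t *: d) &
    minimal_face K (x - t *: d) `<` minimal_face K x].
Proof.
move=> clK cK pK Kx xd d0; have /convex_coneP[_ convK _] := cK.
have [fx [xx FxK cFx]] := minimal_face_cone cK Kx.
have [_ _ FxZ] := cFx.
have [|_ _ hFx] := (faceP _ cK).1 (conj fx _); first by exists x.
have Kd := FxK _ xd.
have [t [t0 Ky exit]] := exit_time clK cK pK Kx Kd d0.
exists t; split=> //; split.
  have [_ _] := minimal_faceP convK Ky; apply => //.
  by apply: (hFx _ (t *: d)) => //; [exact: (FxK _ (FxZ _ _ t0 xd))|rewrite subrK].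
move=> /(_ d xd) yd; have [e e0] := minimal_face_absorb cK Ky yd.
exact: exit e0.
Qed.

Lemma longest_chain_minimal_face (R : realType) (n l m : nat)
    (K : set 'rV[R]_n) (x y : 'rV[R]_n) :
  convex_cone K -> K x -> K y -> minimal_face K y `<` minimal_face K x ->
  longest_chain_length (minimal_face K x) l ->
  longest_chain_length (minimal_face K y) m -> (m < l)%N.
Proof.
move=> cK Kx Ky yx; have [_ [_ FxK cFx]] := minimal_face_cone cK Kx.
have [fy _] := minimal_face_cone cK Ky.
apply: longest_chain_proper => //.
by apply: face_subset fy => //; exact: yx.1.
Qed.

(** Strict inclusion of minimal faces is well founded, being measured by the
    lengths of longest chains. *)
Lemma minimal_face_ind (R : realType) (n : nat) (K : set 'rV[R]_n)
    (P : 'rV[R]_n -> Prop) :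
  convex_cone K ->
  (forall x, K x ->
     (forall y, K y -> minimal_face K y `<` minimal_face K x -> P y) -> P x) ->
  forall x, K x -> P x.
Proof.
move=> cK step.
have cF x : K x -> convex_cone (minimal_face K x).
  by move=> Kx; have [_ []] := minimal_face_cone cK Kx.
suff H l x : K x -> longest_chain_length (minimal_face K x) l -> P x.
  by move=> x Kx; have [l] := longest_chain_ex (cF x Kx); exact: (H l).
elim/ltn_ind: l x => l IHl x Kx xl; apply: step => // y Ky yx.
have [m ym] := longest_chain_ex (cF y Ky).
by apply: (IHl m) => //; exact: (longest_chain_minimal_face cK Kx Ky yx xl ym).
Qed.

(** * Extreme rays and the Carathéodory number *)

Lemma extreme_ray_line (R : realType) (n : nat) (K : set 'rV[R]_n)
    (x : 'rV[R]_n) :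
  convex_cone K -> K x -> x != 0 ->
  (forall w, minimal_face K x w -> w \in <[x]>%VS) ->
  extreme_ray K (minimal_face K x).
Proof.
move=> cK Kx x0 line.
have [fx [xx _ [F0 _ _]]] := minimal_face_cone cK Kx.
split=> //; split; first by exists x.
 exists <[x]>%VS; split; first by rewrite dim_vline x0.
  by move=> u v /line Fu /line Fv; rewrite memvB.
by move=> W WF; rewrite -memvE -(subr0 x); exact: WF.
Qed.

(** A nonzero point whose minimal face is smallest possible spans an extreme ray:
    otherwise the exit point along a direction off its line would have a smaller
    minimal face, and it is nonzero since [x] is not a multiple of the direction. *)
Lemma extreme_ray_ex (R : realType) (n : nat) (K : set 'rV[R]_n)
    (x : 'rV[R]_n) :
  closed K -> convex_cone K -> pointed K -> K x -> x != 0 ->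
  exists F d, [/\ extreme_ray K F, F d, d != 0 & minimal_face K x d].
Proof.
move=> clK cK pK; move: x; apply: minimal_face_ind => // x Kx IH x0.
have [_ [xx _ _]] := minimal_face_cone cK Kx.
have [line|] := pselect (forall w, minimal_face K x w -> w \in <[x]>%VS).
  by exists (minimal_face K x), x; split => //; exact: extreme_ray_line.
move=> /existsNP[w /not_implyP[xw /negP wx]].
have w0 : w != 0 by apply: contraNneq wx => ->; exact: mem0v.
have [t [t0 Ky yx]] := minimal_face_exit clK cK pK Kx xw w0.
have y0 : x - t *: w != 0.
  apply: contraNneq wx => /eqP; rewrite subr_eq0 => /eqP xtw.
  have tn0 : t != 0 by apply: contraNneq x0 => t00; rewrite xtw t00 scale0r.
  by apply/vlineP; exists t^-1; rewrite xtw scalerA mulVf // scale1r.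
have [F [d [eF Fd d0 yd]]] := IH _ Ky yx y0.
by exists F, d; split => //; exact: yx.1.
Qed.

Lemma sum_of_extreme_cons (R : realType) (n k : nat) (K F : set 'rV[R]_n)
    (d x : 'rV[R]_n) :
  extreme_ray K F -> F d -> sum_of_extreme K x k ->
  sum_of_extreme K (d + x) k.+1.
Proof.
move=> eF Fd [f [ef ->]].
exists (fun i => if unlift ord0 i is Some j then f j else d); split.
  by move=> i; case: unliftP => [j _|_]; [exact: ef|exists F].
rewrite big_ord_recl unlift_none; congr (_ + _).
by apply: eq_bigr => i _; rewrite liftK.
Qed.

(** Each descent step costs one extreme summand and shortens the longest chain of
    faces by at least one. *)
Lemma sum_of_extreme_bound (R : realType) (n : nat) (K : set 'rV[R]_n)
    (x : 'rV[R]_n) :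
  closed K -> convex_cone K -> pointed K -> K x ->
  exists2 k, sum_of_extreme K x k &
    forall l, longest_chain_length (minimal_face K x) l -> (k < l)%N.
Proof.
move=> clK cK pK; move: x; apply: minimal_face_ind => // x Kx IH.
have [x0|x0] := eqVneq x 0.
  exists 0%N; first by exists (fun=> 0); rewrite big_ord0; split => // -[].
  by move=> l; apply: longest_chain_gt0; have [_ []] := minimal_face_cone cK Kx.
have [F [d [eF Fd d0 xd]]] := extreme_ray_ex clK cK pK Kx x0.
have [t [t0 Ky yx]] := minimal_face_exit clK cK pK Kx xd d0.
have [k yk kl] := IH _ Ky yx.
have [|_ [_ _ FZ] _] := (faceP _ cK).1 (conj eF.1 _); first by exists d.
exists k.+1.
  rewrite -(subrK (t *: d) x) addrC.
  by apply: sum_of_extreme_cons eF _ yk; exact: FZ.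
move=> l xl; have [_ [_ _ cFy]] := minimal_face_cone cK Ky.
have [m ym] := longest_chain_ex cFy.
apply: leq_ltn_trans (kl _ ym) _.
exact: (longest_chain_minimal_face cK Kx Ky yx xl ym).
Qed.

Theorem theorem4 (R : realType) (n : nat) (K : set 'rV[R]_n)
    (hK : closed_convex_cone K) (hp : pointed K) :
  (forall x : 'rV[R]_n, K x ->
     exists k l : nat,
       [/\ caratheodory_number_at K x k,
           longest_chain_length (minimal_face K x) l &
           k%:Z <= l%:Z - 1]) /\
  (exists k l : nat,
     [/\ caratheodory_number K k,
         longest_chain_length K l &
         k%:Z <= l%:Z - 1]).
Proof.
have [K0 clK convK coneK] := hK.
have cK : convex_cone K by apply/convex_coneP; split.
have pointwise x : K x -> exists k l, [/\ caratheodory_number_at K x k,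
    longest_chain_length (minimal_face K x) l & (k < l)%N].
  move=> Kx; have [_ [_ _ cFx]] := minimal_face_cone cK Kx.
  have [l xl] := longest_chain_ex cFx.
  have [k xk /(_ _ xl) kl] := sum_of_extreme_bound clK cK hp Kx.
  have exk : exists k, `[< sum_of_extreme K x k >] by exists k; exact/asboolP.
  (* The decomposition found need not be the shortest. *)
  have [k' /asboolP xk' kmin] := ex_minnP exk.
  exists k', l; split => //.
    by split=> // j xj; apply: kmin; exact/asboolP.
  by apply: leq_ltn_trans kl; apply: kmin; exact/asboolP.
split.
  move=> x /pointwise[k [l [xk xl kl]]]; exists k, l; split => //; lia.
(* The values of the Caratheodory number on [K] are all below the longest chain
   length of [K], since faces of faces are faces; so they have a maximum. *)
have [l Kl] := longest_chain_ex cK.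
pose P k := `[< exists2 x, K x & caratheodory_number_at K x k >].
have bP k : P k -> (k <= l.-1)%N.
  move=> /asboolP[x Kx [xk kmin]].
  have [k' [m [[xk' _] xm km]]] := pointwise x Kx.
  have [fx _ _] := minimal_faceP convK Kx.
  have := longest_chain_face fx Kl xm.
  have := kmin _ xk'; lia.
have exP : exists k, P k.
  have [K00 _ _] := cK; have [k [_ [xk _ _]]] := pointwise 0 K00.
  by exists k; apply/asboolP; exists 0.
have l0 := longest_chain_gt0 cK Kl.
case: (ex_maxnP exP bP) => k Pk kmax; have kl := bP k Pk.
exists k, l; split => //; last lia.
split; first exact/asboolP.
move=> x Kx; have [j [_ [xj _ _]]] := pointwise x Kx; exists j => //.
by apply: kmax; apply/asboolP; exists x.
Qed.
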